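(* Let $\Bbbk\supseteq\mathbb{Q}$ be a field, $x$ a single variable, and let $\xi\in(x)^2\cdot \mathrm{Der}_\Bbbk(\Bbbk[\![x]\!])$ be a derivation of order $p+1\ge2$, i.e. $\xi=h(x)\partial_x$ with $\mathrm{ord}_x h=p+1$. Let $\omega=\tilde a(x)\,dx$ be the differential form with $\omega(\xi)=1$ (so $\tilde a=1/h$ is a Laurent series of order $-p-1$), let $res_o\omega\in\Bbbk$ be its residue at the origin, and present $$\omega=\Big[\partial_x\frac{1}{c\cdot a(x)^p}+\frac{res_o\omega}{x}\Big]dx,\qquad 0\neq c\in\Bbbk,\quad a(x)-x\in(x)^2\subset\Bbbk[\![x]\!].$$ 1. The power series $y(x)=e^\xi x\in\Bbbk[\![x]\!]$ is determined by the equation $$\frac{1}{c\cdot a(y)^{p}}-\frac{1}{c\cdot a(x)^{p}}+res_o\omega\cdot\ln\frac{y}{x}=1,$$ i.e. it is the unique power series $y\in x+(x)^2$ satisfying this equation. 2. In particular, if $res_o\omega=0$ then $e^\xi x=a^{-1}\Big[\frac{a(x)}{(1+c\cdot a(x)^p)^{1/p}}\Big]$.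
   Context: $e^\xi=\sum_{j\ge0}\frac{\xi^j}{j!}$, a well-defined automorphism of $\Bbbk[\![x]\!]$ since $\xi$ raises the $x$-adic order. Here $a^{-1}[\dots]$ denotes the compositional inverse of the power series $a(x)$; for $u\in 1+(x)$, $\ln u\in(x)$ and $u^{1/p}\in1+(x)$ are defined by the usual power series. The residue is the coefficient of $\frac1x$. *)

(* Defs.v *)
From HB Require Import structures.
From mathcomp Require Import all_boot all_order all_algebra.
From mathcomp Require Import ring zify boolp classical_sets.

Set Implicit Arguments.
Unset Strict Implicit.
Unset Printing Implicit Defensive.

Import GRing.Theory.
Local Open Scope ring_scope.
Local Open Scope quotient_scope.

Record fps (K : fieldType) := Fps { fps_coef :> nat -> K }.

Add Printing Constructor fps.

HB.instance Definition _ (K : fieldType) := gen_eqMixin (fps K).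
HB.instance Definition _ (K : fieldType) := gen_choiceMixin (fps K).

Section Ring.
Variable K : fieldType.
Implicit Types (f g h s t : fps K) (c : K).

Lemma fpsP f g : f =1 g <-> f = g.
Proof.
split=> [|-> //]; case: f g => [f] [g] /= fg.
by congr Fps; apply/funext.
Qed.

Definition fpsC c : fps K := Fps (fun n => if n == 0%N then c else 0).
Definition fpsX : fps K := Fps (fun n => (n == 1%N)%:R).
Definition fps_opp f : fps K := Fps (fun n => - f n).
Definition fps_add f g : fps K := Fps (fun n => f n + g n).
Definition fps_mul f g : fps K :=
  Fps (fun n => \sum_(i < n.+1) f i * g (n - i)%N).
Definition fps_scale c f : fps K := Fps (fun n => c * f n).

Fact fps_addA : associative fps_add.
Proof. by move=> f g h; apply/fpsP => n /=; rewrite addrA. Qed.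
Fact fps_addC : commutative fps_add.
Proof. by move=> f g; apply/fpsP => n /=; rewrite addrC. Qed.
Fact fps_add0 : left_id (fpsC 0) fps_add.
Proof. by move=> f; apply/fpsP => n /=; rewrite if_same add0r. Qed.
Fact fps_addN : left_inverse (fpsC 0) fps_opp fps_add.
Proof. by move=> f; apply/fpsP => n /=; rewrite if_same addNr. Qed.

HB.instance Definition _ :=
  GRing.isZmodule.Build (fps K) fps_addA fps_addC fps_add0 fps_addN.

Definition fps_trunc (N : nat) f : {poly K} := \poly_(i < N) f i.

Fact fps_mul_trunc N f g n : (n < N)%N ->
  fps_mul f g n = (fps_trunc N f * fps_trunc N g)`_n.
Proof.
move=> nN; rewrite coefM /=; apply: eq_bigr => i _.
have iN : (i < N)%N by apply: leq_trans nN; rewrite ltnS -ltnS.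
rewrite !coef_poly iN (leq_ltn_trans _ nN) //.
exact: leq_subr.
Qed.

Fact fps_trunc_mul N f g n : (n < N)%N ->
  (fps_trunc N (fps_mul f g))`_n = (fps_trunc N f * fps_trunc N g)`_n.
Proof. by move=> nN; rewrite coef_poly nN (fps_mul_trunc _ _ nN). Qed.

Fact fps_mulA : associative fps_mul.
Proof.
move=> f g h; apply/fpsP => n; have nN := ltnSn n.
rewrite !(fps_mul_trunc _ _ nN).
transitivity (fps_trunc n.+1 f * (fps_trunc n.+1 g * fps_trunc n.+1 h))`_n.
  rewrite !coefM; apply: eq_bigr => i _.
  by rewrite fps_trunc_mul // ltnS leq_subr.
rewrite mulrA [LHS]coefM [RHS]coefM; apply: eq_bigr => i _.
by rewrite fps_trunc_mul.
Qed.

Fact fps_mulC : commutative fps_mul.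
Proof.
by move=> f g; apply/fpsP => n; rewrite !(fps_mul_trunc _ _ (ltnSn n)) mulrC.
Qed.

Fact fps_mul1 : left_id (fpsC 1) fps_mul.
Proof.
move=> f; apply/fpsP => n /=; rewrite big_ord_recl /= mul1r subn0.
by rewrite big1 ?addr0 // => i _; rewrite mul0r.
Qed.

Fact fps_mulD : left_distributive fps_mul fps_add.
Proof.
move=> f g h; apply/fpsP => n /=; rewrite -big_split /=.
by apply: eq_bigr => i _; rewrite mulrDl.
Qed.

Fact fps_one_neq0 : fpsC 1 != 0 :> fps K.
Proof. by apply/eqP => /fpsP/(_ 0%N)/eqP; rewrite /= oner_eq0. Qed.

HB.instance Definition _ := GRing.Zmodule_isComNzRing.Build (fps K)
  fps_mulA fps_mulC fps_mul1 fps_mulD fps_one_neq0.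

Fact fps_scaleA c d f : fps_scale c (fps_scale d f) = fps_scale (c * d) f.
Proof. by apply/fpsP => n /=; rewrite mulrA. Qed.
Fact fps_scale1 : left_id 1 fps_scale.
Proof. by move=> f; apply/fpsP => n /=; rewrite mul1r. Qed.
Fact fps_scaleDr : right_distributive fps_scale +%R.
Proof. by move=> c f g; apply/fpsP => n /=; rewrite mulrDr. Qed.
Fact fps_scaleDl f : {morph fps_scale^~ f : c d / c + d}.
Proof. by move=> c d; apply/fpsP => n /=; rewrite mulrDl. Qed.

HB.instance Definition _ := GRing.Zmodule_isLmodule.Build K (fps K)
  fps_scaleA fps_scale1 fps_scaleDr fps_scaleDl.

Fact fps_scaleAl c f g : c *: (f * g) = c *: f * g.
Proof.
apply/fpsP => n /=; rewrite mulr_sumr.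
by apply: eq_bigr => i _; rewrite mulrA.
Qed.

HB.instance Definition _ :=
  GRing.Lmodule_isLalgebra.Build K (fps K) fps_scaleAl.
HB.instance Definition _ := GRing.Lalgebra_isComAlgebra.Build K (fps K).

Lemma fps_coef0 n : (0 : fps K) n = 0.
Proof. by rewrite /= if_same. Qed.
Lemma fps_coef1 n : (1 : fps K) n = (n == 0%N)%:R.
Proof. by rewrite /=; case: eqP. Qed.
Lemma fps_coefX n : fpsX n = (n == 1%N)%:R.
Proof. by []. Qed.
Lemma fps_coefD f g n : (f + g) n = f n + g n.
Proof. by []. Qed.
Lemma fps_coefN f n : (- f) n = - f n.
Proof. by []. Qed.
Lemma fps_coefZ c f n : (c *: f) n = c * f n.
Proof. by []. Qed.
Lemma fps_coefM f g n : (f * g) n = \sum_(i < n.+1) f i * g (n - i)%N.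
Proof. by []. Qed.
Lemma fps_coef_sum I (r : seq I) (P : pred I) (F : I -> fps K) n :
  (\sum_(i <- r | P i) F i) n = \sum_(i <- r | P i) F i n.
Proof.
by elim/big_rec2: _ => [|i y x _ <-]; rewrite ?fps_coef0 ?fps_coefD.
Qed.

(* s / x^m, for s \in (x)^m *)
Definition fps_divXn m s : fps K := Fps (fun n => s (m + n)%N).

Lemma fps_coefXnM m s n :
  (fpsX ^+ m * s) n = if (n < m)%N then 0 else s (n - m)%N.
Proof.
elim: m n => [|m IHm] n; first by rewrite expr0 mul1r subn0.
rewrite exprS -mulrA fps_coefM; case: n => [|n].
  by rewrite big_ord1 fps_coefX mul0r.
rewrite 2!big_ord_recl big1 => [|i _]; last by rewrite fps_coefX mul0r.
by rewrite !fps_coefX mul0r add0r mul1r addr0 lift0 !subSS subn0 IHm ltnS.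
Qed.

(* the ideal (x)^m *)
Definition in_xpow m s : Prop := exists g, s = fpsX ^+ m * g.

Lemma in_xpowP m s : in_xpow m s <-> forall i, (i < m)%N -> s i = 0.
Proof.
split=> [[g ->] i im|s0]; first by rewrite fps_coefXnM im.
exists (fps_divXn m s); apply/fpsP => n; rewrite fps_coefXnM.
by case: ltnP => [/s0 //|mn] /=; rewrite subnKC.
Qed.

Lemma fps_divXnK m s : in_xpow m s -> fpsX ^+ m * fps_divXn m s = s.
Proof.
move=> /in_xpowP s0; apply/fpsP => n; rewrite fps_coefXnM.
by case: ltnP => [/s0 //|mn] /=; rewrite subnKC.
Qed.

Lemma in_xpowX m s : in_xpow 1 s -> in_xpow m (s ^+ m).
Proof. by case=> g ->; exists (g ^+ m); rewrite expr1 exprMn. Qed.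

(* Sum of a family with F j \in (x)^j: the terms of index j > n do not
   contribute to the coefficient of x^n. *)
Definition fps_sum (F : nat -> fps K) : fps K :=
  Fps (fun n => \sum_(j < n.+1) F j n).

Lemma fps_sum_widen (F : nat -> fps K) n N :
    (forall j, in_xpow j (F j)) -> (n < N)%N ->
  fps_sum F n = (\sum_(j < N) F j) n.
Proof.
move=> F0 nN; rewrite fps_coef_sum /=.
rewrite (big_ord_widen N (fun j => F j n)) //.
rewrite [RHS](bigID (fun j : 'I_N => (j < n.+1)%N)) /=.
rewrite [X in _ + X]big1 ?addr0 // => j; rewrite -leqNgt => nj.
by have /in_xpowP := F0 j; apply.
Qed.

(* f(g(x)), for g \in (x) *)
Definition fps_comp f g : fps K := fps_sum (fun j => f j *: g ^+ j).

Definition fps_unit : pred (fps K) := fun s => s 0%N != 0.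
(* s^-1 = s_0^-1 * \sum_j (1 - s / s_0)^j *)
Definition fps_inv s : fps K :=
  if s 0%N == 0 then s
  else (s 0%N)^-1 *: fps_sum (fun j => (1 - (s 0%N)^-1 *: s) ^+ j).

Fact fps_mulVr : {in fps_unit, left_inverse 1 fps_inv *%R}.
Proof.
move=> s; rewrite unfold_in => s0; rewrite /fps_inv (negbTE s0).
set t := 1 - _.
have t1 : in_xpow 1 t.
  apply/in_xpowP => -[] // _.
  by rewrite /t fps_coefD fps_coefN fps_coefZ mulVf //= subrr.
have sE : s = s 0%N *: (1 - t).
  by rewrite /t opprB addrC subrK scalerA divff // scale1r.
rewrite [X in _ * X]sE -scalerAl -scalerAr scalerA mulVf // scale1r mulrC.
apply/fpsP => n; transitivity (((1 - t) * \sum_(j < n.+1) t ^+ j) n).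
  rewrite !fps_coefM; apply: eq_bigr => i _; congr (_ * _).
  by apply: fps_sum_widen => [j|]; [exact: in_xpowX | rewrite ltnS leq_subr].
have -> : (1 - t) * (\sum_(j < n.+1) t ^+ j) = 1 - t ^+ n.+1.
  by rewrite -[RHS]opprB subrX1 -mulNr [in RHS]opprB.
have /in_xpowP/(_ n (ltnSn n)) tn := in_xpowX n.+1 t1.
by rewrite fps_coefD fps_coefN tn oppr0 addr0.
Qed.

Fact fps_unitPl s t : t * s = 1 -> fps_unit s.
Proof.
move=> /fpsP/(_ 0%N); rewrite fps_coefM big_ord1 /= => ts.
by apply/eqP => s0; move/eqP: ts; rewrite s0 mulr0 eq_sym oner_eq0.
Qed.

Fact fps_inv_out : {in [predC fps_unit], fps_inv =1 id}.
Proof.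
by move=> s; rewrite inE unfold_in negbK /fps_inv => ->.
Qed.

HB.instance Definition _ := GRing.ComNzRing_hasMulInverse.Build (fps K)
  fps_mulVr fps_unitPl fps_inv_out.

(* least n such that s n != 0; by convention fps_ord 0 = 0 *)
Definition fps_ord s : nat :=
  if pselect (exists n, s n != 0) is left s0 then ex_minn s0 else 0%N.

Lemma fps_ordP s : s != 0 ->
  s (fps_ord s) != 0 /\ forall i, (i < fps_ord s)%N -> s i = 0.
Proof.
move=> s0; rewrite /fps_ord; case: pselect => [p|np]; last first.
  case/eqP: s0; apply/fpsP => n; rewrite fps_coef0.
  by apply/eqP; apply/negPn/negP => sn; apply: np; exists n.
case: ex_minnP => m sm mmin; split=> // i im.
apply/eqP; apply/negPn/negP => /mmin; by rewrite leqNgt im.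
Qed.

Fact fps_mulf_eq0 f g : f * g = 0 -> (f == 0) || (g == 0).
Proof.
move=> fg; apply/norP => -[/fps_ordP[fm f0] /fps_ordP[gm g0]].
set m := fps_ord f in fm f0; set n := fps_ord g in gm g0.
have /fpsP/(_ (m + n)%N) := fg; rewrite fps_coefM fps_coef0.
have mn : (m < (m + n).+1)%N by rewrite ltnS leq_addr.
rewrite (bigD1 (Ordinal mn)) //= addKn big1 ?addr0 => [/eqP|i].
  by rewrite mulf_eq0 (negbTE fm) (negbTE gm).
rewrite -val_eqE /= neq_ltn => /orP[im|mi]; first by rewrite f0 ?mul0r.
rewrite [g _]g0 ?mulr0 // ltn_subLR ?ltn_add2r //.
by rewrite -ltnS.
Qed.

HB.instance Definition _ :=
  GRing.ComUnitRing_isIntegral.Build (fps K) fps_mulf_eq0.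

Definition fps_deriv f : fps K := Fps (fun n => f n.+1 *+ n.+1).

Lemma fps_derivM f g :
  fps_deriv (f * g) = fps_deriv f * g + f * fps_deriv g.
Proof.
apply/fpsP => n; rewrite fps_coefD.
have trE m h : (m <= n)%N ->
    ((fps_trunc n.+2 h)^`())`_m = (fps_trunc n.+2 (fps_deriv h))`_m.
  move=> mn; rewrite coef_deriv !coef_poly /=.
  by rewrite !ltnS mn (leq_trans mn).
have nN : (n < n.+2)%N by [].
transitivity ((fps_trunc n.+2 f * fps_trunc n.+2 g)`_n.+1 *+ n.+1).
  by rewrite -(fps_mul_trunc _ _ (ltnSn n.+1)).
transitivity ((fps_trunc n.+2 (fps_deriv f) * fps_trunc n.+2 g)`_n
    + (fps_trunc n.+2 f * fps_trunc n.+2 (fps_deriv g))`_n); last first.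
  by rewrite -!fps_mul_trunc.
rewrite -coef_deriv derivM coefD !coefM.
congr (_ + _); apply: eq_bigr => i _.
  by rewrite trE // -ltnS.
by rewrite [in LHS]trE // leq_subr.
Qed.

(* the derivation h(x) \partial_x *)
Definition vfield h : fps K -> fps K := fun f => h * fps_deriv f.

(* e^xi f = \sum_j xi^j(f) / j!, for xi mapping each (x)^m to (x)^(m+1) *)
Definition fps_exp_der (xi : fps K -> fps K) f : fps K :=
  fps_sum (fun j => (j`!%:R)^-1 *: iter j xi f).

(* ln u = \sum_(j >= 1) (-1)^(j-1) (u - 1)^j / j, for u \in 1 + (x) *)
Definition fps_ln u : fps K :=
  fps_comp (Fps (fun j => if j == 0%N then 0 else (-1) ^+ j.-1 / j%:R)) (u - 1).

(* u^alpha = \sum_j binom(alpha, j) (u - 1)^j, for u \in 1 + (x) *)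
Definition fps_pow (alpha : K) u : fps K :=
  fps_comp (Fps (fun j => (\prod_(i < j) (alpha - i%:R)) / j`!%:R)) (u - 1).

(* compositional inverse of a \in (x); junk value 0 if there is none *)
Definition fps_comp_inv (a : fps K) : fps K :=
  xget 0 [set b | [/\ in_xpow 1 b, fps_comp a b = fpsX
                    & fps_comp b a = fpsX]]%classic.

End Ring.

Arguments fpsX {K}.

(* the field of Laurent series K((x)), as the fraction field of K[[x]] *)
Notation laurent K := {fraction (fps K)}.
Notation "s %:F" := (FracField.tofrac s) : ring_scope.

Section Laurent.
Variable K : fieldType.
Implicit Types (n d s : fps K) (F : laurent K).

(* If F = n / d with d = x^v * u and u a unit, then F = x^(-v) * (n / u). *)
Definition lcoef F (i : int) : K :=
  let n := \n_(repr F) in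
  let d := \d_(repr F) in
  let v := fps_ord d in
  if i + v%:Z is Posz m then (n / fps_divXn v d) m else 0.

Definition residue F : K := lcoef F (-1).

Definition lderiv F : laurent K :=
  let n := \n_(repr F) in
  let d := \d_(repr F) in
  (fps_deriv n * d - n * fps_deriv d)%:F / (d ^+ 2)%:F.

Lemma laurent_repr F :
  \d_(repr F) != 0 /\ F = (\n_(repr F))%:F / (\d_(repr F))%:F.
Proof.
have d0 : \d_(repr F) != 0 by exact: denom_ratioP.
split=> //; apply: (canRL (mulfK _)); first by rewrite tofrac_eq0.
rewrite -[X in X * _]reprK; apply/eqP.
rewrite -[_ * _]/(FracField.mul _ _) !piE FracField.equivfE.
by rewrite !numden_Ratio ?oner_eq0 ?mulf_neq0 ?oner_eq0 // !mulr1 mulrC.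
Qed.

Lemma laurent_reprE n d : d != 0 ->
  \n_(repr (n%:F / d%:F)) * d = n * \d_(repr (n%:F / d%:F)).
Proof.
move=> d0; have [d'0 /eqP] := laurent_repr (n%:F / d%:F).
rewrite eqr_div ?tofrac_eq0 // -!tofracM tofrac_eq => /eqP ->.
by [].
Qed.

Lemma lderivE n d : d != 0 ->
  lderiv (n%:F / d%:F)
  = (fps_deriv n * d - n * fps_deriv d)%:F / (d ^+ 2)%:F.
Proof.
move=> d0; have [d'0 _] := laurent_repr (n%:F / d%:F).
have := laurent_reprE n d0; rewrite /lderiv.
move: (\n_(repr _)) (\d_(repr _)) d'0 => n' d' d'0 e.
have /(congr1 (@fps_deriv K)) := e; rewrite !fps_derivM => e'.
apply/eqP; rewrite eqr_div ?tofrac_eq0 ?expf_neq0 // -!tofracM tofrac_eq.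
apply/eqP.
have e1 : fps_deriv n' * d - n * fps_deriv d'
  = fps_deriv n * d' - n' * fps_deriv d.
  apply/eqP; rewrite subr_eq addrAC eq_sym subr_eq eq_sym; apply/eqP.
  by rewrite e' addrC.
transitivity (d * d' * (fps_deriv n' * d - n * fps_deriv d')).
  rewrite !mulrBl !mulrBr; congr (_ - _); first by ring.
  transitivity (n' * d * fps_deriv d' * d); first by ring.
  by rewrite e; ring.
rewrite e1 !mulrBl !mulrBr; congr (_ - _); first by ring.
transitivity (n' * d * fps_deriv d * d'); first by ring.
by rewrite e; ring.
Qed.

Lemma lcoefE s v (i : int) :
  lcoef (s%:F / (fpsX ^+ v)%:F) i = if i + v%:Z is Posz m then s m else 0.
Proof.
have X0 : fpsX != 0 :> fps K.
  by apply/eqP => /fpsP/(_ 1%N)/eqP; rewrite fps_coef0 fps_coefX oner_eq0.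
have Xv0 : fpsX ^+ v != 0 :> fps K by rewrite expf_neq0.
have [d0 _] := laurent_repr (s%:F / (fpsX ^+ v)%:F).
have := laurent_reprE s Xv0; rewrite /lcoef.
move: (\n_(repr _)) (\d_(repr _)) d0 => n d d0 e.
have [dw dlt] := fps_ordP d0; move: (fps_ord d) dw dlt => w dw dlt.
have /fps_divXnK dE : in_xpow w d by apply/in_xpowP.
have uU : fps_divXn w d \is a GRing.unit.
  by rewrite unfold_in /= /fps_unit /= addn0.
have ext m (g : fps K) (j : int) :
    (if j is Posz k then g k else 0)
    = (if j + m%:Z is Posz k then (fpsX ^+ m * g) k else 0).
  case: j => j; first by rewrite -PoszD fps_coefXnM addnC ltnNge leq_addr addKn.
  case jm : (Negz j + m%:Z) => [k|//].
  by rewrite fps_coefXnM ifT //; lia.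
rewrite (ext v) [RHS](ext w) addrAC.
have -> // : fpsX ^+ v * (n / fps_divXn w d) = fpsX ^+ w * s.
apply: (mulIr uU); rewrite -mulrA divrK // mulrC e.
by rewrite -[in LHS]dE mulrCA mulrA.
Qed.

End Laurent.

(* Main.v *)
(* Pulling omega back along y = e^xi x preserves it: e^xi substitutes y for x
   and commutes with xi, so h(y) = e^xi (xi x) = xi (e^xi x) = h y'. With
   r = res omega, the function 1/(c a(y)^p) - 1/(c a^p) + r ln(y/x) therefore
   has derivative omega(y) y' - omega = 0, and its constant value 1 is read off
   from y = x + h + O(x^(p+2)). Uniqueness compares leading terms: if two
   solutions differ in order k, the terms 1/(c a^p) differ in order k-p-1, but
   the logarithms only in order >= k-1. *)
Require Import Defs.
From mathcomp Require Import all_boot all_order all_algebra.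
From mathcomp Require Import ring zify boolp classical_sets.

Set Implicit Arguments.
Unset Strict Implicit.
Unset Printing Implicit Defensive.

Import GRing.Theory.
Local Open Scope ring_scope.

(** The statement lives in K((x)), but the arguments are made in K[[x]]. With A = c a^p, B = A(y)
    and r the residue, the presentation of omega becomes x A^2 = h (r A^2 - x A'), and the equation
    for y becomes A - B + r ln(y/x) A B = A B. A quotient f/g with zero derivative then appears as
    f' g = f g', and comparing one coefficient of f and g replaces integration. The constant 1
    arises because the presentation forces A_p = -p h_(p+1). That e^xi is a substitution rests on
    the Leibniz rule for xi^j / j!, which makes e^xi multiplicative: a linear multiplicative map
    respecting the x-adic filtration is composition with its value at x. The numbers c and series a
    are found by integrating 1/h termwise and taking a p-th root. For residue zero the equation is
    an identity between p-th powers, and p-th roots tangent to x are unique. *)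

Section PowerSeries.
Variable K : fieldType.
Implicit Types (f g s t u y z : fps K) (c : K) (m n N : nat).

(** * The x-adic filtration *)

Lemma in_xpow0 s : in_xpow 0 s.
Proof. by apply/in_xpowP. Qed.

Lemma in_xpow_weaken m n s : (m <= n)%N -> in_xpow n s -> in_xpow m s.
Proof.
move=> mn /in_xpowP s0; apply/in_xpowP => i im.
by apply: s0; exact: leq_trans mn.
Qed.

Lemma in_xpow_zero m : in_xpow m (0 : fps K).
Proof. by apply/in_xpowP => i _; rewrite fps_coef0. Qed.

Lemma in_xpowD m s t : in_xpow m s -> in_xpow m t -> in_xpow m (s + t).
Proof.
move=> /in_xpowP s0 /in_xpowP t0; apply/in_xpowP => i im.
by rewrite fps_coefD s0 // t0 // addr0.
Qed.

Lemma in_xpowZ m c s : in_xpow m s -> in_xpow m (c *: s).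
Proof.
by move=> /in_xpowP s0; apply/in_xpowP => i im; rewrite fps_coefZ s0 // mulr0.
Qed.

Lemma in_xpowN m s : in_xpow m s -> in_xpow m (- s).
Proof. by rewrite -scaleN1r; exact: in_xpowZ. Qed.

Lemma in_xpowB m s t : in_xpow m s -> in_xpow m t -> in_xpow m (s - t).
Proof. by move=> ? /in_xpowN; exact: in_xpowD. Qed.

Lemma in_xpowM m n s t : in_xpow m s -> in_xpow n t -> in_xpow (m + n) (s * t).
Proof.
by move=> [s' ->] [t' ->]; exists (s' * t'); rewrite exprD mulrACA.
Qed.

Lemma in_xpowMl m s t : in_xpow m s -> in_xpow m (s * t).
Proof.
by move=> s0; rewrite -[m]addn0; apply: in_xpowM => //; exact: in_xpow0.
Qed.

Lemma in_xpowMr m s t : in_xpow m t -> in_xpow m (s * t).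
Proof. by rewrite mulrC; exact: in_xpowMl. Qed.

Lemma in_xpow_sum I (r : seq I) (P : pred I) (F : I -> fps K) m :
  (forall i, P i -> in_xpow m (F i)) -> in_xpow m (\sum_(i <- r | P i) F i).
Proof.
move=> F0; elim/big_rec: _ => [|i s Pi s0]; first exact: in_xpow_zero.
by apply: in_xpowD => //; exact: F0.
Qed.

Lemma in_xpow_expr m k s : in_xpow m s -> in_xpow (m * k) (s ^+ k).
Proof.
move=> s0; elim: k => [|k IHk]; first by rewrite muln0; exact: in_xpow0.
by rewrite mulnS exprS; exact: in_xpowM.
Qed.

Lemma in_xpowXn m : in_xpow m (fpsX ^+ m : fps K).
Proof. by exists 1; rewrite mulr1. Qed.

Lemma in_xpow_eq f g : (forall N, in_xpow N (f - g)) -> f = g.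
Proof.
move=> fg; apply/fpsP => n; have /in_xpowP/(_ n (ltnSn n)) := fg n.+1.
by rewrite fps_coefD fps_coefN => /eqP; rewrite subr_eq0 => /eqP.
Qed.

Lemma in_xpow_coef n f g : in_xpow n.+1 (f - g) -> f n = g n.
Proof.
move=> /in_xpowP/(_ n (ltnSn n)); rewrite fps_coefD fps_coefN => /eqP.
by rewrite subr_eq0 => /eqP.
Qed.

Lemma fps_coefM_low m n s t :
  in_xpow m s -> in_xpow n t -> (s * t) (m + n)%N = s m * t n.
Proof.
move=> [s' ->] [t' ->]; rewrite mulrACA -exprD !fps_coefXnM !ltnn !subnn.
by rewrite fps_coefM big_ord1.
Qed.

Lemma fps_coef0M s t : (s * t) 0%N = s 0%N * t 0%N.
Proof. by rewrite fps_coefM big_ord1. Qed.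

Lemma fps_coefX_low m k s : in_xpow m s -> (s ^+ k) (m * k)%N = s m ^+ k.
Proof.
move=> s0; elim: k => [|k IHk]; first by rewrite muln0 !expr0.
by rewrite mulnS !exprS fps_coefM_low ?IHk //; exact: in_xpow_expr.
Qed.

Lemma fpsX_neq0 : fpsX != 0 :> fps K.
Proof.
by apply/eqP => /fpsP/(_ 1%N)/eqP; rewrite fps_coef0 fps_coefX oner_eq0.
Qed.

Lemma fps_neq0 m s : s m != 0 -> s != 0.
Proof. by apply: contraNneq => ->; rewrite fps_coef0. Qed.

Lemma fps_expansion N f :
  f = \sum_(j < N) f j *: fpsX ^+ j + fpsX ^+ N * fps_divXn N f.
Proof.
apply/fpsP => n; rewrite fps_coefD fps_coef_sum fps_coefXnM /=.
have XE j : (fpsX ^+ j : fps K) n = (n == j)%:R.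
  rewrite -[_ ^+ _]mulr1 fps_coefXnM fps_coef1.
  by case: ltngtP => // [jn|->]; rewrite ?subnn // subn_eq0 leqNgt jn.
case: ltnP => nN.
  rewrite addr0 (bigD1 (Ordinal nN)) //= XE eqxx mulr1 big1 ?addr0 // => j jn.
  by rewrite XE eq_sym -[_ == _]/(j == Ordinal nN) (negbTE jn) mulr0.
rewrite big1 ?add0r ?subnKC // => j _.
by rewrite XE gtn_eqF ?mulr0 // (leq_trans (ltn_ord j)).
Qed.

Lemma fps_sum_mod (F : nat -> fps K) N :
    (forall j, in_xpow j (F j)) ->
  in_xpow N (fps_sum F - \sum_(j < N) F j).
Proof.
move=> F0; apply/in_xpowP => i iN.
by rewrite fps_coefD fps_coefN -(fps_sum_widen F0 iN) subrr.
Qed.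

(** * Composition of power series *)

Definition substitution (phi : fps K -> fps K) : Prop :=
  [/\ forall c f g, phi (c *: f + g) = c *: phi f + phi g,
      forall f g, phi (f * g) = phi f * phi g, phi 1 = 1
    & forall m f, in_xpow m f -> in_xpow m (phi f)].

Lemma fps_comp_mod N f y : in_xpow 1 y ->
  in_xpow N (fps_comp f y - \sum_(j < N) f j *: y ^+ j).
Proof.
move=> y0; apply: fps_sum_mod => j; apply: in_xpowZ.
by rewrite -[X in in_xpow X _]mul1n; exact: in_xpow_expr.
Qed.

Lemma fps_comp_linear c f g y :
  fps_comp (c *: f + g) y = c *: fps_comp f y + fps_comp g y.
Proof.
apply/fpsP => n; rewrite fps_coefD fps_coefZ /= mulr_sumr -big_split /=.
by apply: eq_bigr => j _; rewrite mulrDl mulrA.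
Qed.

Lemma fps_compD f g y : fps_comp (f + g) y = fps_comp f y + fps_comp g y.
Proof. by rewrite -[f]scale1r fps_comp_linear !scale1r. Qed.

Lemma fps_comp0 y : fps_comp 0 y = 0.
Proof. by apply: (addIr (fps_comp 0 y)); rewrite -fps_compD !add0r. Qed.

Lemma fps_compZ c f y : fps_comp (c *: f) y = c *: fps_comp f y.
Proof. by rewrite -[_ *: f]addr0 fps_comp_linear fps_comp0 addr0. Qed.

Lemma fps_comp_sum (I : finType) (F : I -> fps K) y :
  fps_comp (\sum_i F i) y = \sum_i fps_comp (F i) y.
Proof.
have compD f g : fps_comp (f + g) y = fps_comp f y + fps_comp g y.
  exact: fps_compD.
exact: (big_morph (fun f => fps_comp f y) compD (fps_comp0 y)).
Qed.

Lemma fps_compXnM m g y : in_xpow 1 y ->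
  fps_comp (fpsX ^+ m * g) y = y ^+ m * fps_comp g y.
Proof.
move=> y0; apply: in_xpow_eq => N.
have := fps_comp_mod (m + N) (fpsX ^+ m * g) y0.
have := fps_comp_mod N g y0.
rewrite big_split_ord [X in _ - (X + _)]big1 => [|j _]; last first.
  by rewrite fps_coefXnM /= ltn_ord scale0r.
set S := \sum_(j < N) _; set T := \sum_(j < N) _.
have -> : T = y ^+ m * S.
  rewrite /T /S mulr_sumr; apply: eq_bigr => j _.
  by rewrite fps_coefXnM /= ltnNge leq_addr addKn -scalerAr exprD.
rewrite add0r => gS /(in_xpow_weaken (leq_addl m N)) fS.
have -> : fps_comp (fpsX ^+ m * g) y - y ^+ m * fps_comp g y =
  fps_comp (fpsX ^+ m * g) y - y ^+ m * S - y ^+ m * (fps_comp g y - S) by ring.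
by apply: in_xpowB => //; exact: in_xpowMr.
Qed.

Lemma fps_comp1 y : fps_comp 1 y = 1.
Proof.
apply/fpsP => n; rewrite /= big_ord_recl big1 => [|j _]; last first.
  by rewrite mul0r.
by rewrite expr0 mul1r addr0.
Qed.

Lemma fps_compXn m y : in_xpow 1 y -> fps_comp (fpsX ^+ m) y = y ^+ m.
Proof.
by move=> y0; rewrite -[_ ^+ m in LHS]mulr1 fps_compXnM // fps_comp1 mulr1.
Qed.

Lemma fps_compX y : in_xpow 1 y -> fps_comp fpsX y = y.
Proof. by move=> y0; rewrite -[fpsX]expr1 fps_compXn ?expr1. Qed.

Lemma in_xpow_comp m f y : in_xpow 1 y -> in_xpow m f ->
  in_xpow m (fps_comp f y).
Proof.
move=> y0 [g ->]; rewrite fps_compXnM //; apply: in_xpowMl.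
by rewrite -[X in in_xpow X _]mul1n; exact: in_xpow_expr.
Qed.

(** Only f is expanded: on monomials the claim is [fps_compXnM], and the remainder x^N (...)
    contributes a multiple of y^N to both sides, which is zero modulo (x)^N. *)
Lemma fps_compM f g y : in_xpow 1 y ->
  fps_comp (f * g) y = fps_comp f y * fps_comp g y.
Proof.
move=> y0; apply: in_xpow_eq => N.
rewrite [f](fps_expansion N) mulrDl mulr_suml !fps_compD -mulrA !fps_compXnM //.
rewrite !fps_comp_sum mulrDl mulr_suml opprD addrACA; apply: in_xpowD.
  rewrite -sumrB big1 => [|j _]; first exact: in_xpow_zero.
  by rewrite -scalerAl !fps_compZ fps_compXnM // fps_compXn // -scalerAl subrr.
rewrite -mulrA -mulrBr; apply: in_xpowMl.
by rewrite -[X in in_xpow X _]mul1n; exact: in_xpow_expr.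
Qed.

Lemma fps_comp_expr f m y : in_xpow 1 y ->
  fps_comp (f ^+ m) y = fps_comp f y ^+ m.
Proof.
move=> y0; elim: m => [|m IHm]; first by rewrite !expr0 fps_comp1.
by rewrite !exprS fps_compM // IHm.
Qed.

(** Linearity and multiplicativity determine [phi] on polynomials; the filtration condition is
    x-adic continuity and extends this to all series. It serves to read e^xi as evaluation at e^xi
    x. *)
Lemma substitutionE phi f : substitution phi -> phi f = fps_comp f (phi fpsX).
Proof.
move=> [lin mul one filt].
have phiD g k : phi (g + k) = phi g + phi k by rewrite -[g]scale1r lin !scale1r.
have phi0 : phi 0 = 0 by apply: (addIr (phi 0)); rewrite -phiD !add0r.
have phiZ c g : phi (c *: g) = c *: phi g.
  by rewrite -[_ *: g]addr0 lin phi0 addr0.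
have phiXn m : phi (fpsX ^+ m) = phi fpsX ^+ m.
  by elim: m => [|m IHm]; rewrite ?expr0 ?one // !exprS mul IHm.
have y0 : in_xpow 1 (phi fpsX) by apply: filt; exact: (in_xpowXn 1).
apply: in_xpow_eq => N.
rewrite [X in phi X](fps_expansion N) phiD mul phiXn.
rewrite (big_morph phi phiD phi0).
under eq_bigr do rewrite phiZ phiXn.
have := fps_comp_mod N f y0; set S := \sum_(j < N) _ => /in_xpowN fS.
have -> k : S + k - fps_comp f (phi fpsX) = - (fps_comp f (phi fpsX) - S) + k.
  by ring.
apply: in_xpowD => //; apply: in_xpowMl.
by rewrite -[X in in_xpow X _]mul1n; exact: in_xpow_expr.
Qed.

Lemma fps_comp_fpsX f : fps_comp f fpsX = f.
Proof. by rewrite -(substitutionE (phi := id)). Qed.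

Lemma fps_compA f g y : in_xpow 1 g -> in_xpow 1 y ->
  fps_comp (fps_comp f g) y = fps_comp f (fps_comp g y).
Proof.
(* As a function of f the left side is itself a substitution, so its value at x decides. *)
move=> g0 y0; pose phi f := fps_comp (fps_comp f g) y.
rewrite -/(phi f) (substitutionE (phi := phi)) /phi; first by rewrite fps_compX.
split=> [c f1 f2|f1 f2||m f1 f10]; first by rewrite !fps_comp_linear.
- by rewrite !fps_compM.
- by rewrite !fps_comp1.
- by do 2 apply: in_xpow_comp => //.
Qed.

End PowerSeries.

(** * Derivatives, powers and logarithms *)

Section Derivative.
Variable K : fieldType.
Implicit Types (f g h s t u y z : fps K) (c : K) (m n N : nat).

Lemma fps_derivD f g : fps_deriv (f + g) = fps_deriv f + fps_deriv g.
Proof. by apply/fpsP => n; rewrite /= mulrnDl. Qed.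

Lemma fps_derivZ c f : fps_deriv (c *: f) = c *: fps_deriv f.
Proof. by apply/fpsP => n; rewrite /= mulrnAr. Qed.

Lemma fps_derivB f g : fps_deriv (f - g) = fps_deriv f - fps_deriv g.
Proof. by rewrite fps_derivD -scaleN1r fps_derivZ scaleN1r. Qed.

Lemma fps_deriv0 : fps_deriv (0 : fps K) = 0.
Proof. by apply/fpsP => n; rewrite /= mul0rn if_same. Qed.

Lemma fps_deriv1 : fps_deriv (1 : fps K) = 0.
Proof. by apply/fpsP => n; rewrite /= mul0rn if_same. Qed.

Lemma fps_derivX : fps_deriv (fpsX : fps K) = 1.
Proof. by apply/fpsP => -[|n]; rewrite /= ?mul0rn. Qed.

Lemma fps_deriv_expr f m :
  fps_deriv (f ^+ m) = (f ^+ m.-1 * fps_deriv f) *+ m.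
Proof.
case: m => [|m] /=; first by rewrite fps_deriv1 mulr0n.
elim: m => [|m IHm]; first by rewrite expr1 expr0 mul1r mulr1n.
by rewrite [in LHS]exprS fps_derivM IHm mulrnAr mulrA -exprS [RHS]mulrS mulrC.
Qed.

Lemma in_xpow_deriv m f : in_xpow m.+1 f -> in_xpow m (fps_deriv f).
Proof.
by move=> /in_xpowP f0; apply/in_xpowP => i im; rewrite /= f0 ?mul0rn.
Qed.

Lemma euler_coef f n : (fpsX * fps_deriv f) n = n%:R * f n.
Proof.
rewrite -[fpsX]expr1 fps_coefXnM; case: n => [|n]; first by rewrite mul0r.
by rewrite ltnS ltn0 subn1 /= mulr_natl.
Qed.

Lemma coef_1DX_mul f n :
  ((1 + fpsX) * f) n = f n + (if n is m.+1 then f m else 0).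
Proof.
rewrite mulrDl mul1r fps_coefD -[fpsX]expr1 fps_coefXnM.
by case: n => [|n] //; rewrite ltnS ltn0 subn1.
Qed.

Lemma fps_deriv_comp f y : in_xpow 1 y ->
  fps_deriv (fps_comp f y) = fps_comp (fps_deriv f) y * fps_deriv y.
Proof.
move=> y0; apply: in_xpow_eq => N.
(* One extra order of precision, since differentiation loses one. *)
have /in_xpow_deriv := fps_comp_mod N.+1 f y0.
have := fps_comp_mod N (fps_deriv f) y0.
set S := \sum_(j < N) _; set T := \sum_(j < N.+1) _ => dS dT.
have -> : fps_deriv (fps_comp f y) - fps_comp (fps_deriv f) y * fps_deriv y =
   (fps_deriv (fps_comp f y - T))
     - (fps_comp (fps_deriv f) y - S) * fps_deriv y
     + (fps_deriv T - S * fps_deriv y) by rewrite fps_derivB; ring.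
apply: in_xpowD; first by apply: in_xpowB => //; exact: in_xpowMl.
suff -> : fps_deriv T = S * fps_deriv y.
  by rewrite subrr; apply/in_xpowP => i _; rewrite fps_coef0.
rewrite /T /S (big_morph (@fps_deriv K) fps_derivD fps_deriv0).
rewrite big_ord_recl expr0 fps_derivZ fps_deriv1 scaler0 add0r mulr_suml.
apply: eq_bigr => j _; rewrite fps_derivZ fps_deriv_expr /= -scalerAl.
by rewrite -scalerMnr scalerMnl.
Qed.

Hypothesis charK0 : [pchar K] =i pred0.

Lemma natr_neq0 n : (n.+1%:R : K) != 0.
Proof. by rewrite ((pcharf0P K).1 charK0). Qed.

Lemma natr_inj m n : (m%:R : K) = n%:R -> m = n.
Proof.
wlog mn : m n / (m <= n)%N => [IH e|e].
  by case/orP: (leq_total m n) => /IH; [exact|move=> /(_ (esym e))].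
have /eqP : (n - m)%:R = 0 :> K by rewrite natrB // e subrr.
rewrite ((pcharf0P K).1 charK0) subn_eq0 => nm.
by apply/eqP; rewrite eqn_leq mn.
Qed.

(* The hypothesis says (f / g)' = 0 without division. *)
Lemma proportional d c f g :
    fps_deriv f * g = f * fps_deriv g -> in_xpow d g -> g d != 0 ->
  f d = c * g d -> f = c *: g.
Proof.
move=> fg g0 gd fd; apply/eqP; rewrite -subr_eq0; apply/negPn/negP.
set k := f - _ => /fps_ordP[]; set m := fps_ord k => km k0.
have {}k0 : in_xpow m k by apply/in_xpowP.
have kg : fps_deriv k * g = k * fps_deriv g.
  by rewrite /k fps_derivB fps_derivZ !mulrBl fg -!scalerAl [g * _]mulrC.
have md : m <> d.
  move=> md; move: km.
  by rewrite md /k fps_coefD fps_coefN fps_coefZ fd subrr eqxx.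
have eulerP n s : in_xpow n s -> in_xpow n (fpsX * fps_deriv s).
  move=> /in_xpowP s0; apply/in_xpowP => i /s0 si.
  by rewrite euler_coef si mulr0.
(* The Euler operator x d/dx multiplies a leading coefficient by its order, so coefficient m + d of
   x k' g = k x g' forces m = d in characteristic zero. But k vanishes at d by the choice of c. *)
have : (fpsX * fps_deriv k * g) (m + d)%N
     = (k * (fpsX * fps_deriv g)) (m + d)%N.
  by rewrite -mulrA kg mulrCA.
rewrite !fps_coefM_low ?euler_coef //; [|exact: eulerP|exact: eulerP].
by rewrite -mulrA [RHS]mulrCA => /(mulIf (mulf_neq0 km gd))/natr_inj.
Qed.

Lemma sub1_in_xpow u : u 0%N = 1 -> in_xpow 1 (u - 1).
Proof.
by move=> u0; apply/in_xpowP => -[|//] _; rewrite fps_coefD fps_coefN u0 subrr.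
Qed.

(** After factoring out composition with u - 1 this is (1 + x) b' = alpha b for the binomial series
    b, that is, the recursion (m+1) b_(m+1) = (alpha - m) b_m. *)
Lemma fps_deriv_pow (alpha : K) u : u 0%N = 1 ->
  u * fps_deriv (fps_pow alpha u) = alpha *: (fps_pow alpha u * fps_deriv u).
Proof.
move=> /sub1_in_xpow u1; rewrite /fps_pow; set b := Fps _.
rewrite fps_deriv_comp // fps_derivB fps_deriv1 subr0 mulrA.
have {1}-> : u = fps_comp (1 + fpsX) (u - 1).
  by rewrite fps_compD fps_comp1 fps_compX // addrC subrK.
rewrite -fps_compM // scalerAl -fps_compZ; congr (fps_comp _ _ * _).
apply/fpsP => n; rewrite coef_1DX_mul fps_coefZ.
have bS m : fps_deriv b m = (alpha - m%:R) * b m.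
  rewrite /= big_ord_recr factS natrM /= -[LHS]mulr_natr.
  have : (m`!%:R : K) != 0.
    by have := fact_gt0 m; case: (m`!) => // k _; exact: natr_neq0.
  move: (m`!%:R) (m.+1%:R : K) (natr_neq0 m) => F d d0 F0.
  by field; rewrite d0 F0.
rewrite bS; case: n => [|n]; first by rewrite subr0 addr0.
by rewrite -[fps_deriv b n]/(b n.+1 *+ n.+1) -[b _ *+ _]mulr_natl; ring.
Qed.

Lemma pow_coef0 (alpha : K) u : u 0%N = 1 -> fps_pow alpha u 0%N = 1.
Proof.
move=> u0; rewrite /fps_pow /= big_ord_recl big_ord0 /= big_ord0.
by rewrite fact0 invr1 !mulr1 addr0.
Qed.

(** Both w^p and u solve f' u = f u' and have constant term 1, so [proportional] identifies them
    without any binomial identity. *)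
Lemma pow_invK p u : (0 < p)%N -> u 0%N = 1 ->
  fps_pow (p%:R^-1) u ^+ p = u.
Proof.
move=> p0 u0; set w := fps_pow _ u.
have w0 : w 0%N = 1 by exact: pow_coef0.
rewrite -[RHS]scale1r; apply: (@proportional 0); last 3 first.
- exact: in_xpow0.
- by rewrite u0 oner_eq0.
- have := fps_coefX_low p (in_xpow0 w); rewrite mul0n => ->.
  by rewrite w0 expr1n u0 mul1r.
rewrite fps_deriv_expr mulrnAl -mulrA [_ * u]mulrC fps_deriv_pow //.
rewrite -/w -scalerAr mulrA -exprSr prednK // -scaler_nat scalerA.
by case: p p0 w w0 => // p _ w _; rewrite divff ?scale1r ?natr_neq0.
Qed.

Lemma fps_deriv_ln u : u 0%N = 1 -> u * fps_deriv (fps_ln u) = fps_deriv u.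
Proof.
move=> /sub1_in_xpow u1; rewrite /fps_ln; set l := Fps _.
rewrite fps_deriv_comp // fps_derivB fps_deriv1 subr0 mulrA.
have {1}-> : u = fps_comp (1 + fpsX) (u - 1).
  by rewrite fps_compD fps_comp1 fps_compX // addrC subrK.
rewrite -fps_compM //; suff -> : (1 + fpsX) * fps_deriv l = 1.
  by rewrite fps_comp1 mul1r.
have lS m : fps_deriv l m = (-1) ^+ m.
  by rewrite /= -[LHS]mulr_natr divfK ?natr_neq0.
apply/fpsP => n; rewrite coef_1DX_mul fps_coef1 lS.
by case: n => [|n]; rewrite ?addr0 // lS exprS mulN1r addNr.
Qed.

Lemma ln_coef0 u : fps_ln u 0%N = 0.
Proof. by rewrite /fps_ln /= big_ord_recl big_ord0 mul0r add0r. Qed.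

End Derivative.

(** * Series tangent to the identity *)

Section TangentToIdentity.
Variable K : fieldType.
Implicit Types (a b f g y z : fps K).

Lemma tangent_in_xpow a : in_xpow 2 (a - fpsX) -> in_xpow 1 a.
Proof.
move=> a2; rewrite -[a](subrK fpsX); apply: in_xpowD.
  exact: in_xpow_weaken a2.
exact: (in_xpowXn _ 1).
Qed.

Lemma tangent_coef1 a : in_xpow 2 (a - fpsX) -> a 1%N = 1.
Proof. by move=> /in_xpow_coef ->. Qed.

Lemma tangentP a : in_xpow 1 a -> a 1%N = 1 -> in_xpow 2 (a - fpsX).
Proof.
move=> /in_xpowP a0 a1; apply/in_xpowP => -[|[|//]] _.
  by rewrite fps_coefD fps_coefN a0 // fps_coefX subrr.
by rewrite fps_coefD fps_coefN a1 fps_coefX subrr.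
Qed.

Lemma tangent_expr_coef a n : in_xpow 2 (a - fpsX) -> (a ^+ n) n = 1.
Proof.
move=> a2; have := fps_coefX_low n (tangent_in_xpow a2).
by rewrite mul1n => ->; rewrite tangent_coef1 // expr1n.
Qed.

Lemma tangent_expr_in_xpow a n : in_xpow 2 (a - fpsX) -> in_xpow n (a ^+ n).
Proof. by move=> /tangent_in_xpow/in_xpow_expr-/(_ n); rewrite mul1n. Qed.

(** Since a^m = x^m + ..., adding e x^m to an approximation changes its composite with a by exactly
    e in degree m and by nothing below. Step m thus removes the error in degree m. Later steps leave
    that coefficient alone, so [b] may read it off [G m.+1]. *)
Lemma left_inverse_exists a : in_xpow 2 (a - fpsX) ->
  exists2 b, fps_comp b a = fpsX & in_xpow 2 (b - fpsX).
Proof.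
move=> a2; have a1 := tangent_in_xpow a2.
pose fix G n : fps K := if n is m.+1
  then G m + (fpsX - fps_comp (G m) a) m *: fpsX ^+ m else 0.
have GP n : in_xpow n (fpsX - fps_comp (G n) a).
  elim: n => [|n IHn]; first exact: in_xpow0.
  rewrite [G _]/= fps_compD fps_compZ fps_compXn // opprD addrA.
  apply/in_xpowP => i; rewrite ltnS leq_eqVlt => /orP[/eqP ->|ilt].
    by rewrite fps_coefD fps_coefN fps_coefZ tangent_expr_coef // mulr1 subrr.
  rewrite fps_coefD fps_coefN fps_coefZ.
  have /in_xpowP/(_ i ilt) -> := IHn.
  have /in_xpowP/(_ i ilt) -> := tangent_expr_in_xpow n a2.
  by rewrite mulr0 subrr.
pose b : fps K := Fps (fun j => G j.+1 j).
have bG n : in_xpow n (b - G n).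
  apply/in_xpowP => i; elim: n => // n IHn.
  rewrite ltnS leq_eqVlt => /orP[/eqP <-|ilt].
    by rewrite fps_coefD fps_coefN [b i]/= subrr.
  rewrite -(IHn ilt) !fps_coefD !fps_coefN [G n.+1]/= fps_coefD fps_coefZ.
  by rewrite -[_ ^+ n]mulr1 fps_coefXnM ilt mulr0 addr0.
have ba : fps_comp b a = fpsX.
  apply/esym/in_xpow_eq => n; rewrite -[b](subrK (G n)) fps_compD opprD addrCA.
  by apply: in_xpowD => //; apply/in_xpowN/in_xpow_comp.
exists b => //; move: (b) ba => {bG}b ba.
have b0 : b 0%N = 0.
  by have /fpsP/(_ 0%N) := ba; rewrite /= big_ord_recl big_ord0 addr0 mulr1.
apply: tangentP; first by apply/in_xpowP => -[|//] _.
have /fpsP/(_ 1%N) := ba; rewrite /= 2!big_ord_recl big_ord0 addr0.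
by rewrite /= mulr0 add0r expr1 tangent_coef1 // mulr1.
Qed.

Lemma fps_comp_invP a : in_xpow 2 (a - fpsX) ->
  in_xpow 1 (fps_comp_inv a) /\ fps_comp (fps_comp_inv a) a = fpsX.
Proof.
move=> a2; have [b ba b2] := left_inverse_exists a2.
(* A left inverse c of b gives c = c(b(a)) = a, so b is two-sided and [fps_comp_inv] does not fall
   back on its default. *)
have [c cb c2] := left_inverse_exists b2.
have [a1 b1] := (tangent_in_xpow a2, tangent_in_xpow b2).
have ca : c = a.
  by rewrite -[c]fps_comp_fpsX -ba -fps_compA // cb fps_compX.
have : exists b, [/\ in_xpow 1 b, fps_comp a b = fpsX & fps_comp b a = fpsX].
  by exists b; split=> //; rewrite -ca.
by move=> /(@xgetPex _ 0 [set b | _]%classic)[].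
Qed.

Lemma in_xpow_geom m y z : in_xpow 1 y -> in_xpow 1 z ->
  in_xpow m.-1 (\sum_(i < m) z ^+ (m.-1 - i) * y ^+ i).
Proof.
move=> y1 z1; apply: in_xpow_sum => i _.
have {1}-> : m.-1 = (1 * (m.-1 - i) + 1 * i)%N.
  by rewrite !mul1n subnK //; case: m i => [[]|m i] //=; rewrite -ltnS.
by apply: in_xpowM; exact: in_xpow_expr.
Qed.

(** In z^m - y^m = (z - y) (...) the second factor is a sum of m products, each with leading term
    x^(m-1); this is the factor m. For m = 0 everything is zero, so the truncated predecessor is
    harmless. *)
Lemma tangent_expr_sub m k y z :
    in_xpow 2 (y - fpsX) -> in_xpow 2 (z - fpsX) -> in_xpow k (z - y) ->
  in_xpow (k + m.-1) (z ^+ m - y ^+ m) /\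
  (z ^+ m - y ^+ m) (k + m.-1)%N = (z - y) k * m%:R.
Proof.
move=> y2 z2 zy; have [y1 z1] := (tangent_in_xpow y2, tangent_in_xpow z2).
have S0 := in_xpow_geom m y1 z1.
rewrite subrXX.
split; first exact: in_xpowM.
rewrite fps_coefM_low //; congr (_ * _); rewrite fps_coef_sum.
rewrite -[m in RHS]card_ord -sumr_const; apply: eq_bigr => i _.
have im : (m.-1 = (m.-1 - i) + i)%N.
  by rewrite subnK //; case: m i {S0} => [[]|m i] //=; rewrite -ltnS.
rewrite {2}im fps_coefM_low ?tangent_expr_coef ?mulr1 //.
  exact: tangent_expr_in_xpow.
exact: tangent_expr_in_xpow.
Qed.

(* The leading term of f(z) - f(y) is that of f'(x) (z - y). *)
Lemma tangent_comp_sub m k f y z :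
    (0 < m)%N -> (0 < k)%N -> in_xpow 2 (y - fpsX) -> in_xpow 2 (z - fpsX) ->
    in_xpow k (z - y) -> in_xpow m f ->
  in_xpow (k + m.-1) (fps_comp f z - fps_comp f y) /\
  (fps_comp f z - fps_comp f y) (k + m.-1)%N = (z - y) k * (f m * m%:R).
Proof.
move=> m0 k0 y2 z2 zy /in_xpowP f0.
have E n : (fps_comp f z - fps_comp f y) n =
    \sum_(j < n.+1) f j * (z ^+ j - y ^+ j) n.
  rewrite fps_coefD fps_coefN /= -sumrB; apply: eq_bigr => j _.
  by rewrite -mulrBr.
have small j n : (n < k + m.-1 \/ n = k + m.-1 /\ m < j)%N ->
    f j * (z ^+ j - y ^+ j) n = 0.
  case: (ltnP j m) => [/f0 -> _|mj]; first by rewrite mul0r.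
  have [/in_xpowP s0 _] := tangent_expr_sub j y2 z2 zy.
  by move=> h; rewrite s0 ?mulr0 //; lia.
split.
  by apply/in_xpowP => i ik; rewrite E big1 // => j _; apply: small; left.
have mk : (m < (k + m.-1).+1)%N by lia.
rewrite E (bigD1 (Ordinal mk)) //= big1 ?addr0 => [|j].
  have [_ e] := tangent_expr_sub m y2 z2 zy.
  by rewrite [RHS]mulrCA -e.
rewrite -val_eqE /= neq_ltn => /orP[/f0 ->|mj]; first by rewrite mul0r.
by apply: small; right.
Qed.

End TangentToIdentity.

(** * The exponential of h d/dx as a substitution *)

Section Flow.
Variables (K : fieldType) (h : fps K).
Hypotheses (charK0 : [pchar K] =i pred0) (h2 : in_xpow 2 h).
Implicit Types (f g : fps K) (c : K) (m n N : nat).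

Local Notation xi := (vfield h).

Lemma vfieldD f g : xi (f + g) = xi f + xi g.
Proof. by rewrite /vfield fps_derivD mulrDr. Qed.

Lemma vfieldZ c f : xi (c *: f) = c *: xi f.
Proof. by rewrite /vfield fps_derivZ -scalerAr. Qed.

Lemma vfieldM f g : xi (f * g) = xi f * g + f * xi g.
Proof. by rewrite /vfield fps_derivM; ring. Qed.

Lemma vfield0 : xi 0 = 0.
Proof. by rewrite /vfield fps_deriv0 mulr0. Qed.

Lemma vfield_in_xpow m f : in_xpow m f -> in_xpow m.+1 (xi f).
Proof.
case: m => [|m] f0.
  by apply: in_xpow_weaken (_ : in_xpow 2 _) => //; exact: in_xpowMl.
exact: (in_xpowM h2 (in_xpow_deriv f0)).
Qed.

Definition exp_term j f : fps K := (j`!%:R)^-1 *: iter j xi f.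

Lemma exp_term0 f : exp_term 0 f = f.
Proof. by rewrite /exp_term fact0 invr1 scale1r. Qed.

Lemma exp_term_linear j c f g :
  exp_term j (c *: f + g) = c *: exp_term j f + exp_term j g.
Proof.
rewrite /exp_term.
suff -> : iter j xi (c *: f + g) = c *: iter j xi f + iter j xi g.
  by rewrite scalerDr !scalerA mulrC.
by elim: j => //= j ->; rewrite vfieldD vfieldZ.
Qed.

Lemma exp_term_in_xpow m j f : in_xpow m f -> in_xpow (m + j) (exp_term j f).
Proof.
move=> f0; apply: in_xpowZ; elim: j => [|j IHj]; first by rewrite addn0.
by rewrite addnS; exact: vfield_in_xpow.
Qed.

Lemma vfield_exp_term j f : xi (exp_term j f) = j.+1%:R *: exp_term j.+1 f.
Proof.
rewrite /exp_term vfieldZ scalerA -iterS; congr (_ *: _).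
by rewrite factS natrM invfM mulrA divff ?mul1r // natr_neq0.
Qed.

Lemma exp_term_vfield j f : exp_term j (xi f) = xi (exp_term j f).
Proof. by rewrite /exp_term vfieldZ -iterSr iterS. Qed.

(** Divided powers xi^j / j! absorb the binomial coefficients. In the induction, xi applied to the
    sum gives the term with index i out of n + 1 the weight i + (n + 1 - i), and n + 1 is then
    cancelled. *)
Lemma exp_term_leibniz n f g :
  exp_term n (f * g) = \sum_(i < n.+1) exp_term i f * exp_term (n - i) g.
Proof.
elim: n => [|n IHn]; first by rewrite big_ord1 !exp_term0.
have n0 := natr_neq0 charK0 n.
apply: (scalerI n0); rewrite -vfield_exp_term IHn.
rewrite (big_morph _ vfieldD vfield0).
under eq_bigr => i _ do
  rewrite vfieldM !vfield_exp_term -scalerAl -(scalerAr (n - i).+1%:R).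
rewrite big_split /=; pose T i := exp_term i f * exp_term (n.+1 - i) g.
transitivity
  (\sum_(i < n.+2) i%:R *: T i + \sum_(i < n.+2) (n.+1 - i)%:R *: T i).
  congr (_ + _).
    rewrite [RHS]big_ord_recl scale0r add0r; apply: eq_bigr => i _.
    by rewrite /T /= subSS.
  rewrite [RHS]big_ord_recr /= subnn scale0r addr0; apply: eq_bigr => i _.
  by rewrite /T subSn // -ltnS.
rewrite -big_split scaler_sumr; apply: eq_bigr => i _ /=.
by rewrite -scalerDl -natrD subnKC // -ltnS.
Qed.

Lemma exp_mod N f :
  in_xpow N (fps_exp_der xi f - \sum_(j < N) exp_term j f).
Proof.
by apply: fps_sum_mod => j; exact: (exp_term_in_xpow j (in_xpow0 f)).
Qed.

Lemma expM f g :
  fps_exp_der xi (f * g) = fps_exp_der xi f * fps_exp_der xi g.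
Proof.
apply: in_xpow_eq => N.
have := exp_mod N (f * g); have := exp_mod N f; have := exp_mod N g.
set Sg := \sum_(j < N) _; set Sf := \sum_(j < N) _; set Sfg := \sum_(j < N) _.
move=> gS fS fgS.
(* An auxiliary polynomial variable records the index j: evaluation at 1 recovers the truncated
   sums, and [coefM] sorts their product by total index. *)
pose P k : {poly fps K} := \poly_(j < N) exp_term j k.
have PS k : (P k).[1] = \sum_(j < N) exp_term j k.
  rewrite (horner_coef_wide _ (size_poly N _)); apply: eq_bigr => j _.
  by rewrite coef_poly ltn_ord expr1n mulr1.
have SS : in_xpow N (Sfg - Sf * Sg).
  rewrite /Sf /Sg -!PS -hornerM (@horner_coef_wide _ (N + N)); last first.
    apply: leq_trans (size_polyMleq _ _) _; apply: leq_trans (leq_pred _) _.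
    by apply: leq_add; exact: size_poly.
  (* Total indices below N match the Leibniz formula; the coefficient at N + j already lies in
     (x)^(N+j). *)
  rewrite big_split_ord /= opprD addrA; apply: in_xpowB.
    rewrite -sumrB big1 => [|j _]; first exact: in_xpow_zero.
    rewrite expr1n mulr1 coefM exp_term_leibniz -sumrB big1 // => i _.
    have iN : (i < N)%N by apply: leq_ltn_trans (ltn_ord j); rewrite -ltnS.
    rewrite !coef_poly iN (leq_ltn_trans _ (ltn_ord j)) ?subrr //.
    exact: leq_subr.
  apply: in_xpow_sum => j _; rewrite expr1n mulr1 coefM.
  apply: in_xpow_sum => i _.
  apply: (in_xpow_weaken (leq_addr j N)).
  have coefP k l : in_xpow l (P k)`_l.
    rewrite coef_poly; case: ifP => _; last exact: in_xpow_zero.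
    exact: (exp_term_in_xpow l (in_xpow0 k)).
  have {1}-> : (N + j = i + (N + j - i))%N by rewrite subnKC // -ltnS.
  by apply: in_xpowM.
have -> : fps_exp_der xi (f * g) - fps_exp_der xi f * fps_exp_der xi g =
    (fps_exp_der xi (f * g) - Sfg) + (Sfg - Sf * Sg)
    - (fps_exp_der xi f - Sf) * fps_exp_der xi g
    - Sf * (fps_exp_der xi g - Sg) by ring.
apply: in_xpowB; last exact: in_xpowMr.
by apply: in_xpowB; [exact: in_xpowD|exact: in_xpowMl].
Qed.

Lemma exp_substitution : substitution (fps_exp_der xi).
Proof.
split=> [c f g|f g||m f f0]; last 1 first.
- apply/in_xpowP => i im /=; rewrite big1 // => j _.
  have /in_xpowP := exp_term_in_xpow j f0; apply.
  exact: ltn_addr.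
- apply/fpsP => n; rewrite fps_coefD fps_coefZ /= mulr_sumr -big_split /=.
  apply: eq_bigr => j _.
  by have /fpsP/(_ n) := exp_term_linear j c f g.
- exact: expM.
- apply/fpsP => n; rewrite /= big_ord_recl big1 => [|j _].
    by rewrite addr0 fact0 invr1 mul1r.
  rewrite lift0 iterSr /vfield fps_deriv1 mulr0 (iter_fix _ vfield0).
  by rewrite fps_coef0 mulr0.
Qed.

Lemma exp_vfield f : fps_exp_der xi (xi f) = xi (fps_exp_der xi f).
Proof.
apply: in_xpow_eq => N; have := exp_mod N (xi f).
have := in_xpow_weaken (leqnSn N) (vfield_in_xpow (exp_mod N f)).
have vfieldB g k : xi (g - k) = xi g - xi k.
  by rewrite vfieldD -scaleN1r vfieldZ scaleN1r.
rewrite vfieldB (big_morph _ vfieldD vfield0).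
under eq_bigr do rewrite -exp_term_vfield.
set S := \sum_(j < N) _ => fS xifS.
have -> : fps_exp_der xi (xi f) - xi (fps_exp_der xi f) =
  (fps_exp_der xi (xi f) - S) - (xi (fps_exp_der xi f) - S) by ring.
exact: in_xpowB.
Qed.

Local Notation y := (fps_exp_der xi fpsX).

Lemma comp_flow : fps_comp h y = h * fps_deriv y.
Proof.
rewrite -(substitutionE _ exp_substitution) -[in RHS]/(xi y) -exp_vfield.
by rewrite /vfield fps_derivX mulr1.
Qed.

(** The terms with j >= 2 apply xi at least once to xi x = h, and xi raises the order. The exponent
    is shifted: p here plays the role of p - 1 in the theorem. *)
Lemma flow_first_order p : in_xpow p.+2 h -> in_xpow p.+3 (y - fpsX - h).
Proof.
move=> hp; have := exp_mod p.+3 fpsX.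
have xiX : xi fpsX = h by rewrite /vfield fps_derivX mulr1.
rewrite 2!big_ord_recl exp_term0 lift0 /exp_term /= invr1 scale1r xiX.
set S := \sum_(i < _) _ => yS.
have -> : y - fpsX - h = y - (fpsX + (h + S)) + S by ring.
apply: in_xpowD => //; apply: in_xpow_sum => i _; apply: in_xpowZ.
rewrite /= -!iterS !iterSr xiX; elim: {i}(0 + i)%N => [|i IHi].
  exact: vfield_in_xpow.
by rewrite iterS; apply: in_xpow_weaken (vfield_in_xpow IHi).
Qed.

End Flow.

(** * Clearing denominators *)

Section LaurentEquations.
Variable K : fieldType.
Implicit Types (A B L h s t : fps K) (r : K).

Lemma fpsC_scale r : fpsC r = r *: 1.
Proof.
apply/fpsP => n; rewrite fps_coefZ fps_coef1 /=.
by case: eqP; rewrite ?mulr1 ?mulr0.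
Qed.

Lemma scale_fpsC r s : r *: s = fpsC r * s.
Proof. by rewrite fpsC_scale -scalerAl mul1r. Qed.

(** Stated in a bare field, with a' a mere letter, so that [field] applies; [presentation_fps]
    instantiates it in K((x)) and returns to K[[x]] by injectivity of the embedding. *)
Lemma presentation_field (F : fieldType) (a a' h r x : F) :
    a != 0 -> h != 0 -> x != 0 ->
  h^-1 = - a' / a ^+ 2 + r / x <-> x * a ^+ 2 = h * (r * a ^+ 2 - x * a').
Proof.
move=> a0 h0 x0; split=> e.
  transitivity (x * a ^+ 2 * h * h^-1); first by field.
  by rewrite e; field; rewrite a0 x0.
have -> : h^-1 = x * a ^+ 2 / (x * a ^+ 2 * h) by field; rewrite a0 x0 h0.
by rewrite {1}e; field; rewrite a0 x0 h0.
Qed.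

Lemma time_one_field (F : fieldType) (a b r l : F) : a != 0 -> b != 0 ->
  1 / b - 1 / a + r * l = 1 <-> a - b + r * (l * (a * b)) = a * b.
Proof.
move=> a0 b0; split=> e.
  by rewrite -[RHS]mulr1 -[X in _ = _ * X]e; field; rewrite a0 b0.
apply: (mulIf (mulf_neq0 a0 b0)); rewrite [RHS]mul1r.
by transitivity (a - b + r * (l * (a * b))) => //; field; rewrite a0 b0.
Qed.

Lemma presentation_fps A h r (atilde : laurent K) :
    A != 0 -> h != 0 -> atilde * h%:F = 1 ->
  atilde = lderiv (1 / A%:F) + (fpsC r)%:F / fpsX%:F <->
  fpsX * A ^+ 2 = h * (r *: A ^+ 2 - fpsX * fps_deriv A).
Proof.
move=> A0 h0 ah; have X0 := fpsX_neq0 K.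
have [FA Fh FX] : [/\ A%:F != 0, h%:F != 0 & fpsX%:F != 0 :> laurent K].
  by rewrite !tofrac_eq0.
have -> : atilde = (h%:F)^-1 by apply: (mulIf Fh); rewrite ah mulVf.
rewrite -tofrac1 lderivE // fps_deriv1 mul0r mul1r sub0r scale_fpsC.
have := presentation_field (fps_deriv A)%:F (fpsC r)%:F FA Fh FX.
rewrite -!tofracXn -!tofracM -!tofracN -tofracD -tofracM => ->.
by split=> [/eqP|->//]; rewrite tofrac_eq => /eqP.
Qed.

Lemma time_one_fps A B L r : A != 0 -> B != 0 ->
  1 / B%:F - 1 / A%:F + (r *: L)%:F = 1 :> laurent K <->
  A - B + r *: (L * (A * B)) = A * B.
Proof.
move=> A0 B0.
have [FA FB] : A%:F != 0 /\ B%:F != 0 by rewrite !tofrac_eq0.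
rewrite !scale_fpsC tofracM.
have := time_one_field (fpsC r)%:F L%:F FA FB.
rewrite -!tofracM -tofracN -!tofracD => ->.
by split=> [/eqP|->//]; rewrite tofrac_eq => /eqP.
Qed.

End LaurentEquations.

(* Primes stand for derivatives: (1/b - 1/a + r l)' = 0 for a = A(x), b = A(y),
   v = y/x and l = ln v, with denominators cleared. *)
Lemma wronskian_identity (R : comNzRingType)
    (a a' b b' l l' r x v v' y y' h : R) :
    y = x * v ->
    x * a ^+ 2 = h * (r * a ^+ 2 - x * a') ->
    y * b ^+ 2 = h * (r * (y' * b ^+ 2) - y * b') ->
    v * l' = v' -> y' = v + x * v' ->
  h * x * v * ((a' - b' + r * (l' * (a * b) + l * (a' * b + a * b'))) * (a * b))
  = h * x * v * ((a - b + r * (l * (a * b))) * (a' * b + a * b')).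
Proof.
move=> -> ea eb el ey.
have ea' : h * x * a' = h * r * a ^+ 2 - x * a ^+ 2 by rewrite ea; ring.
have eb' : h * (x * v) * b' = h * r * (y' * b ^+ 2) - x * v * b ^+ 2.
  by rewrite eb; ring.
(* The added bracket is the difference of the two sides. The two presentations reduce it to r h a^2
   b^2 (v - y' + x v'), which is zero. *)
transitivity (h * x * v * ((a - b + r * (l * (a * b))) * (a' * b + a * b'))
  + (v * b ^+ 2 * (h * x * a') - a ^+ 2 * (h * (x * v) * b')
     + r * h * x * a ^+ 2 * b ^+ 2 * (v * l'))); first by ring.
by rewrite ea' eb' el ey; ring.
Qed.

Lemma in_xpow_comp_sub (K : fieldType) k (f y z : fps K) :
    in_xpow 1 y -> in_xpow 1 z -> in_xpow k (z - y) ->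
  in_xpow k (fps_comp f z - fps_comp f y).
Proof.
move=> y1 z1 /in_xpowP zy; apply/in_xpowP => i ik.
rewrite fps_coefD fps_coefN /= -sumrB big1 // => j _; rewrite -mulrBr.
have /in_xpowP/(_ i ik) : in_xpow k (z ^+ j - y ^+ j).
  by rewrite subrXX; apply: in_xpowMl; apply/in_xpowP.
by rewrite fps_coefD fps_coefN => ->; rewrite mulr0.
Qed.

(** * The equation of the time-one map, for A = c a^p *)

Section TimeOneMap.
Variables (K : fieldType) (p : nat) (r : K) (A h : fps K).
Hypotheses (charK0 : [pchar K] =i pred0) (p_gt0 : (0 < p)%N).
Hypotheses (hp : in_xpow p.+1 h) (Ap : in_xpow p A) (A_neq0 : A p != 0).
Hypothesis presA : fpsX * A ^+ 2 = h * (r *: A ^+ 2 - fpsX * fps_deriv A).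
Implicit Types (y z : fps K).

Local Notation log y := (fps_ln (fps_divXn 1 y)).

Lemma tangent_divX y : in_xpow 2 (y - fpsX) -> y = fpsX * fps_divXn 1 y.
Proof.
by move=> /tangent_in_xpow/fps_divXnK; rewrite expr1.
Qed.

Lemma tangent_divX_coef0 y : in_xpow 2 (y - fpsX) -> fps_divXn 1 y 0%N = 1.
Proof. by move=> /tangent_coef1. Qed.

Lemma comp_lead y : in_xpow 2 (y - fpsX) ->
  in_xpow p (fps_comp A y) /\ fps_comp A y p = A p.
Proof.
move=> y2; have y1 := tangent_in_xpow y2; split; first exact: in_xpow_comp.
have X2 : in_xpow 2 (fpsX - fpsX : fps K) by rewrite subrr; exact: in_xpow_zero.
have [/in_xpowP/(_ p)] := tangent_comp_sub (k := 2) p_gt0 isT X2 y2 y2 Ap.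
rewrite fps_comp_fpsX fps_coefD fps_coefN => e _.
by apply/eqP; rewrite -subr_eq0 e //; lia.
Qed.

Lemma comp_neq0 y : in_xpow 2 (y - fpsX) -> fps_comp A y != 0.
Proof. by move=> /comp_lead[_ e]; apply: (@fps_neq0 _ p); rewrite e. Qed.

(** This is coefficient 2p + 1 of [presA]: r A^2 has order at least 2p > p, so the factor
    multiplying h has leading coefficient -p A_p. *)
Lemma lead_eq : A p = - (p%:R * h p.+1).
Proof.
have XA : in_xpow p (fpsX * fps_deriv A).
  by apply/in_xpowP => i ip; rewrite euler_coef (in_xpowP p A).1 // mulr0.
have A2 : in_xpow (p + p) (A ^+ 2) by rewrite expr2; exact: in_xpowM.
have A2p : in_xpow p (A ^+ 2) by apply: in_xpow_weaken A2; exact: leq_addr.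
have /fpsP/(_ (p.+1 + p)%N) := presA.
rewrite [in RHS]fps_coefM_low //; last first.
  by apply: in_xpowB => //; exact: in_xpowZ.
rewrite fps_coefD fps_coefN fps_coefZ euler_coef.
have /in_xpowP -> := A2; last by lia.
have -> : (p.+1 + p = 1 + (p + p))%N by [].
rewrite fps_coefM_low //; last exact: (in_xpowXn _ 1).
rewrite expr2 fps_coefM_low // fps_coefX mul1r mulr0 sub0r => e.
by apply: (mulIf A_neq0); rewrite e; ring.
Qed.

Lemma time_one_equation y :
    in_xpow p.+2 (y - fpsX - h) -> fps_comp h y = h * fps_deriv y ->
  A - fps_comp A y + r *: (log y * (A * fps_comp A y)) = A * fps_comp A y.
Proof.
move=> yh hy.
have yp : in_xpow p.+1 (y - fpsX).
  rewrite -[_ - _](subrK h); apply: in_xpowD => //.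
  exact: in_xpow_weaken yh.
have y2 : in_xpow 2 (y - fpsX) by apply: in_xpow_weaken yp; lia.
have y1 := tangent_in_xpow y2.
have [Bp Bl] := comp_lead y2.
(* Substituting y into [presA] and using h(y) = h y' and A'(y) y' = A(y)': this is the pulled-back
   form. *)
have presB : y * fps_comp A y ^+ 2 =
    h * (r *: (fps_deriv y * fps_comp A y ^+ 2) - y * fps_deriv (fps_comp A y)).
  have := congr1 (fun f => fps_comp f y) presA.
  rewrite /= !fps_compM // fps_compD -scaleN1r !fps_compZ !fps_compM //.
  rewrite -expr2 fps_compX // hy fps_deriv_comp // => ->.
  by rewrite scaleN1r !scale_fpsC; ring.
have v0 := tangent_divX_coef0 y2.
have yE := tangent_divX y2.
have L' := fps_deriv_ln charK0 v0.
have Lx : in_xpow 1 (log y) by apply/in_xpowP => -[|//] _; exact: ln_coef0.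
(* Source of the constant 1: as y - x starts with h, A - A(y) starts with -p A_p h_(p+1), which is
   A_p^2 by [lead_eq], the leading coefficient of A A(y). *)
have AB : (A - fps_comp A y) (p + p)%N = A p * A p.
  have -> : (p + p = p.+1 + p.-1)%N by lia.
  have X2 : in_xpow 2 (fpsX - fpsX : fps K).
    by rewrite subrr; exact: in_xpow_zero.
  have [_] := tangent_comp_sub (k := p.+1) p_gt0 isT X2 y2 yp Ap.
  rewrite fps_comp_fpsX (in_xpow_coef yh) => e.
  by rewrite -opprB fps_coefN e {2}lead_eq; ring.
move: (fps_comp A y) (log y) Bp Bl presB L' Lx AB => B L Bp Bl presB L' Lx AB.
(* The quotient of the two sides has zero derivative, so coefficient 2p decides. The logarithm has
   no constant term, hence its summand starts in degree at least 2p + 1 and does not interfere. *)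
rewrite -[RHS]scale1r; apply: (@proportional _ charK0 (p + p)).
- have hX : h * fpsX * fps_divXn 1 y != 0.
    rewrite !mulf_neq0 ?fpsX_neq0 //.
      apply: contraNneq A_neq0 => h0.
      by rewrite lead_eq h0 fps_coef0 mulr0 oppr0.
    by apply: (@fps_neq0 _ 0); rewrite v0 oner_eq0.
  apply: (mulfI hX).
  rewrite fps_derivD fps_derivB fps_derivZ !fps_derivM.
  have presA' := presA; rewrite scale_fpsC in presA'.
  rewrite !scale_fpsC in presB *.
  have y' : fps_deriv y = fps_divXn 1 y + fpsX * fps_deriv (fps_divXn 1 y).
    by rewrite {1}yE fps_derivM fps_derivX mul1r.
  exact: wronskian_identity yE presA' presB L' y'.
- exact: in_xpowM.
- by rewrite fps_coefM_low // Bl mulf_neq0.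
rewrite mul1r fps_coefD fps_coefZ.
have /in_xpowP -> := in_xpowM Lx (in_xpowM Ap Bp); last by lia.
rewrite mulr0 addr0 fps_coefM_low // Bl.
by rewrite AB.
Qed.

Lemma time_one_unique y z :
    in_xpow 2 (y - fpsX) -> in_xpow 2 (z - fpsX) ->
    A - fps_comp A y + r *: (log y * (A * fps_comp A y)) = A * fps_comp A y ->
    A - fps_comp A z + r *: (log z * (A * fps_comp A z)) = A * fps_comp A z ->
  y = z.
Proof.
move=> y2 z2 ey ez; apply/esym/eqP; rewrite -subr_eq0; apply/negPn/negP.
move=> zy0; have [] := fps_ordP zy0; set k := fps_ord _ => zyk zy.
have {zy}zyP : in_xpow k (z - y) by apply/in_xpowP.
have k_gt0 : (0 < k)%N.
  rewrite lt0n; apply/eqP => k0; move: zyk; rewrite k0.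
  have [/in_xpowP y1 /in_xpowP z1] := (tangent_in_xpow y2, tangent_in_xpow z2).
  by rewrite fps_coefD fps_coefN y1 // z1 // subrr eqxx.
have [_] := tangent_comp_sub p_gt0 k_gt0 y2 z2 zyP Ap.
have [Bp _] := comp_lead y2; have [Cp _] := comp_lead z2.
have A0 : A != 0 by exact: fps_neq0 A_neq0.
(* Multiply the equation of y by A(z), that of z by A(y), subtract, and cancel A. *)
have diff : fps_comp A z - fps_comp A y =
    r *: ((log z - log y) * (fps_comp A y * fps_comp A z)).
  apply: (mulfI A0); move: ey ez; rewrite !scale_fpsC => ey ez.
  move: (fps_comp A y) (fps_comp A z) (log y) (log z) ey ez => B C L M ey ez.
  apply/eqP; rewrite -subr_eq0; apply/eqP.
  transitivity ((A - B + fpsC r * (L * (A * B)) - A * B) * C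
     - (A - C + fpsC r * (M * (A * C)) - A * C) * B); first by ring.
  by rewrite ey ez !subrr !mul0r subrr.
have logP : in_xpow k.-1 (log z - log y).
  have [v0 w0] := (tangent_divX_coef0 y2, tangent_divX_coef0 z2).
  apply: in_xpow_comp_sub; [exact: sub1_in_xpow|exact: sub1_in_xpow|].
  rewrite opprB addrA subrK; apply/in_xpowP => i ik.
  have /in_xpowP/(_ (1 + i)%N) := zyP; apply; lia.
(* The left side has coefficient p A_p (z - y)_k in degree k + p - 1. The right side has order at
   least (k - 1) + 2p, one order having been lost in dividing by x before taking logarithms. *)
rewrite diff.
have /in_xpowP -> := in_xpowZ r (in_xpowM logP (in_xpowM Bp Cp)); last by lia.
move=> e; move: (mulf_neq0 zyk (mulf_neq0 A_neq0 (natr_neq0 charK0 p.-1))).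
by rewrite prednK // -e eqxx.
Qed.

End TimeOneMap.

(** * Existence of the presentation, and the conclusion *)

Lemma fps_unitE (K : fieldType) (s : fps K) :
  (s \is a GRing.unit) = (s 0%N != 0).
Proof. by []. Qed.

(** Factoring h = x^(p+1) u with u a unit gives 1/h the shape required by [lcoefE], where exponent
    -1 corresponds to index p of u^-1. *)
Lemma residue_quotient (K : fieldType) (p : nat) (h : fps K)
    (atilde : laurent K) :
    in_xpow p.+1 h -> h p.+1 != 0 -> atilde * h%:F = 1 ->
  residue atilde = (fps_divXn p.+1 h)^-1 p.
Proof.
move=> hp h_neq0 ah; set u := fps_divXn _ _.
have hE : h = fpsX ^+ p.+1 * u by rewrite fps_divXnK.
have uU : u \is a GRing.unit by rewrite fps_unitE /= addn0.
have X0 : (fpsX ^+ p.+1)%:F != 0 :> laurent K.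
  by rewrite tofrac_eq0 expf_neq0 // fpsX_neq0.
have h0 : h%:F != 0 :> laurent K by rewrite tofrac_eq0 (fps_neq0 h_neq0).
have -> : atilde = (u^-1)%:F / (fpsX ^+ p.+1)%:F.
  apply: (mulIf h0); rewrite ah hE tofracM mulrA divfK //.
  by rewrite -tofracM mulVr // tofrac1.
rewrite /residue lcoefE.
by have -> : (-1 + p.+1%:Z = Posz p)%R by lia.
Qed.

(** If t / x^p is a primitive of 1/h minus its residue term, then c a^p must be x^p / t. Normalizing
    the constant term yields c = 1/t_0 and a = x (t_0 / t)^(1/p). *)
Lemma presentation_exists (K : fieldType) (p : nat) (h : fps K) :
    [pchar K] =i pred0 -> (0 < p)%N -> in_xpow p.+1 h -> h p.+1 != 0 ->
  exists (c : K) (a : fps K), [/\ c != 0, in_xpow 2 (a - fpsX) &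
    fpsX * (c *: a ^+ p) ^+ 2 =
    h * ((fps_divXn p.+1 h)^-1 p *: (c *: a ^+ p) ^+ 2
         - fpsX * fps_deriv (c *: a ^+ p))].
Proof.
move=> charK0 p_gt0 hp h_neq0; set u := fps_divXn _ _; set s := u^-1.
have hE : h = fpsX ^+ p.+1 * u by rewrite fps_divXnK.
have u0 : u 0%N != 0 by rewrite /= addn0.
have us : u * s = 1 by rewrite mulrV ?fps_unitE.
have s0 : s 0%N != 0.
  have /fpsP/(_ 0%N) := us; rewrite fps_coef0M fps_coef1 eqxx => e.
  by apply: contra_eq_neq e => ->; rewrite mulr0 eq_sym oner_eq0.
(* t / x^p is the primitive of s / x^(p+1) without its residue term; the
   division by zero at i = p yields t_p = 0. *)
pose t : fps K := Fps (fun i => s i / (i%:R - p%:R)).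
have subp i : i != p -> (i%:R - p%:R : K) != 0.
  by apply: contraNneq => /subr0_eq/(natr_inj charK0) ->.
(* Equivalent to (t / x^p)' = s / x^(p+1) - s_p / x. *)
have tE : fpsX * fps_deriv t = p%:R *: t + s - s p *: fpsX ^+ p.
  apply/fpsP => i; rewrite euler_coef !(fps_coefD, fps_coefN, fps_coefZ).
  rewrite -[fpsX ^+ p]mulr1 fps_coefXnM fps_coef1.
  have [->|ip] := eqVneq i p; first by rewrite ltnn subnn mulr1 addrK.
  have -> : (if (i < p)%N then 0 else (i - p == 0)%N%:R) = 0 :> K.
    by case: ltnP => // pi; rewrite subn_eq0 leqNgt ltn_neqAle eq_sym ip pi.
  rewrite mulr0 subr0; apply/eqP; rewrite addrC -subr_eq -mulrBl; apply/eqP.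
  by rewrite /= mulrC divfK // subp.
pose c := (t 0%N)^-1.
have t0 : t 0%N != 0 by rewrite /= mulf_neq0 // invr_eq0 subp // eq_sym -lt0n.
have tU : t \is a GRing.unit by rewrite fps_unitE.
have v0 : (t 0%N *: t^-1) 0%N = 1.
  rewrite fps_coefZ; have /fpsP/(_ 0%N) := mulrV tU.
  by rewrite fps_coef0M fps_coef1.
pose w := fps_pow (p%:R^-1) (t 0%N *: t^-1).
have w0 : w 0%N = 1 by exact: pow_coef0.
have AE : c *: (fpsX * w) ^+ p = fpsX ^+ p * t^-1.
  rewrite exprMn (pow_invK charK0 p_gt0 v0) -scalerAr scalerA mulVf //.
  by rewrite scale1r.
exists c, (fpsX * w); split; first by rewrite invr_eq0.
  apply: tangentP; first exact: in_xpowMl (in_xpowXn _ 1).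
  rewrite -[1%N]/(1 + 0)%N fps_coefM_low ?w0 ?mulr1 //; last exact: in_xpow0.
  exact: (in_xpowXn _ 1).
rewrite AE; set A := _ * t^-1.
have At : A * t = fpsX ^+ p by rewrite /A divrK.
have t20 : t ^+ 2 != 0 by rewrite expf_neq0 // (fps_neq0 t0).
(* Multiplying by t^2 lets A t = x^p turn the inverse of t into monomials. *)
apply: (mulIf t20).
have A't : fpsX * fps_deriv A * t
    = p%:R *: fpsX ^+ p - A * (fpsX * fps_deriv t).
  have := congr1 (fun f => fpsX * fps_deriv f) At.
  rewrite fps_derivM fps_deriv_expr fps_derivX mulr1 mulrnAr -exprS prednK //.
  by rewrite scaler_nat => <-; ring.
transitivity (fpsX * (A * t) ^+ 2); first by ring.
transitivity (h * (s p *: (A * t) ^+ 2 - (fpsX * fps_deriv A * t) * t)).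
2: by rewrite !scale_fpsC; ring.
rewrite A't tE At hE.
transitivity (fpsX ^+ p.+1 * u * (s * fpsX ^+ p)); last first.
  congr (_ * _); rewrite !scale_fpsC -At; ring.
rewrite (exprS fpsX p).
transitivity (fpsX * fpsX ^+ p * (u * s) * fpsX ^+ p); last by ring.
by rewrite us; ring.
Qed.

(** The first nonzero coefficient of z - y would reappear, multiplied by p, in z^p - y^p. This
    settles which p-th root occurs in the residue-free formula. *)
Lemma tangent_expr_inj (K : fieldType) (p : nat) (y z : fps K) :
    [pchar K] =i pred0 -> (0 < p)%N ->
    in_xpow 2 (y - fpsX) -> in_xpow 2 (z - fpsX) -> z ^+ p = y ^+ p -> z = y.
Proof.
move=> charK0 p_gt0 y2 z2 zyp; apply/eqP; rewrite -subr_eq0.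
apply/negPn/negP => zy0; have [] := fps_ordP zy0; set k := fps_ord _ => zyk zy.
have zyP : in_xpow k (z - y) by apply/in_xpowP.
have [_ /esym/eqP] := tangent_expr_sub p y2 z2 zyP.
rewrite zyp subrr fps_coef0 mulf_eq0 (negbTE zyk) /=.
by rewrite -(prednK p_gt0) (negbTE (natr_neq0 charK0 _)).
Qed.

Theorem lemma3p1 (K : fieldType) (charK0 : [pchar K] =i pred0)
    (p : nat) (p_gt0 : (0 < p)%N)
    (h : fps K) (ord_h : fps_ord h = p.+1)
    (atilde : laurent K) (omega_xi : atilde * h%:F = 1) :
  let present (c : K) (a : fps K) :=
    [/\ c != 0, in_xpow 2 (a - fpsX)
      & atilde = lderiv (1 / (c *: a ^+ p)%:F)
                 + (fpsC (residue atilde))%:F / fpsX%:F] in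
  (exists c a, present c a) /\
  forall (c : K) (a : fps K), present c a ->
    unique (fun y : fps K =>
      in_xpow 2 (y - fpsX) /\
      1 / (c *: fps_comp a y ^+ p)%:F - 1 / (c *: a ^+ p)%:F
        + (residue atilde *: fps_ln (fps_divXn 1 y))%:F = 1)
      (fps_exp_der (vfield h) fpsX) /\
    (residue atilde = 0 ->
      fps_exp_der (vfield h) fpsX
      = fps_comp (fps_comp_inv a)
          (a / fps_pow (p%:R^-1) (1 + c *: a ^+ p))).
Proof.
move=> present.
have h_neq0 : h != 0.
  by apply: contra_eq_neq omega_xi => ->; rewrite tofrac0 mulr0 eq_sym oner_eq0.
have [] := fps_ordP h_neq0; rewrite ord_h => hlead h0.
have {h0}hp : in_xpow p.+1 h by apply/in_xpowP.
have h2 : in_xpow 2 h by apply: in_xpow_weaken hp.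
have powP (c : K) (a : fps K) : c != 0 -> in_xpow 2 (a - fpsX) ->
    in_xpow p (c *: a ^+ p) /\ (c *: a ^+ p) p != 0.
  move=> c0 a2; split; first exact: in_xpowZ (tangent_expr_in_xpow p a2).
  by rewrite fps_coefZ tangent_expr_coef // mulr1.
split.
  have [c [a [c0 a2 e]]] := presentation_exists charK0 p_gt0 hp hlead.
  exists c, a; split=> //; have [_ /fps_neq0 A0] := powP c a c0 a2.
  apply/(presentation_fps _ A0 h_neq0 omega_xi).
  by rewrite (residue_quotient hp hlead omega_xi).
move=> c a [c0 a2]; have [Ap Al] := powP c a c0 a2.
have A0 := fps_neq0 Al.
move/(presentation_fps _ A0 h_neq0 omega_xi); move: (residue atilde) => r e.
set y := fps_exp_der _ _.
have yh : in_xpow p.+2 (y - fpsX - h).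
  case: (p) p_gt0 hp => // p' _ hp'; exact: flow_first_order.
have y2 : in_xpow 2 (y - fpsX).
  rewrite -[_ - _](subrK h); apply: in_xpowD => //.
  exact: in_xpow_weaken yh.
have compA (z : fps K) : in_xpow 2 (z - fpsX) ->
    fps_comp (c *: a ^+ p) z = c *: fps_comp a z ^+ p.
  by move=> /tangent_in_xpow z1; rewrite fps_compZ fps_comp_expr.
have eqE (z : fps K) : in_xpow 2 (z - fpsX) ->
    1 / (c *: fps_comp a z ^+ p)%:F - 1 / (c *: a ^+ p)%:F
      + (r *: fps_ln (fps_divXn 1 z))%:F = 1 :> laurent K <->
    c *: a ^+ p - fps_comp (c *: a ^+ p) z
      + r *: (fps_ln (fps_divXn 1 z)
              * ((c *: a ^+ p) * fps_comp (c *: a ^+ p) z))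
    = (c *: a ^+ p) * fps_comp (c *: a ^+ p) z.
  move=> z2; rewrite -compA //; apply: time_one_fps => //.
  exact: (comp_neq0 p_gt0 Ap Al z2).
have ey := time_one_equation charK0 p_gt0 hp Ap Al e yh (comp_flow charK0 h2).
split.
  split; first by split=> //; apply/eqE.
  move=> z [z2 /(eqE z z2) ez].
  exact: (time_one_unique charK0 p_gt0 Ap Al y2 z2 ey ez).
move=> r0; move: ey; rewrite r0 scale0r addr0 compA // => ey.
have y1 := tangent_in_xpow y2; have a1 := tangent_in_xpow a2.
have al : a 1%N != 0 by rewrite tangent_coef1 // oner_eq0.
have [b1 bl] := comp_lead (isT : (0 < 1)%N) a1 al y2.
have u0 : (1 + c *: a ^+ p) 0%N = 1.
  by rewrite fps_coefD fps_coef1; have /in_xpowP -> := Ap; rewrite ?addr0.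
set w := fps_pow _ _.
have w0 : w 0%N = 1 by exact: pow_coef0.
(* With r = 0 the equation says c a^p = c a(y)^p (1 + c a^p), so both sides here have the same p-th
   power; both are tangent to x. *)
have aE : a = fps_comp a y * w.
  apply: (tangent_expr_inj charK0 p_gt0 _ a2).
    apply: tangentP; first exact: in_xpowMl.
    rewrite -[1%N]/(1 + 0)%N fps_coefM_low //; last exact: in_xpow0.
    by rewrite bl tangent_coef1 // w0 mulr1.
  rewrite exprMn (pow_invK charK0 p_gt0 u0); apply: (scalerI c0).
  rewrite mulrDr mulr1 scalerDr scalerAl -[in RHS]/(c *: _).
  by rewrite [_ * (c *: _)]mulrC -ey addrC subrK.
have [ai1 aiK] := fps_comp_invP a2.
have -> : a / w = fps_comp a y.
  by rewrite {1}aE mulrK // fps_unitE w0 oner_eq0.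
by rewrite -fps_compA // aiK fps_compX.
Qed.
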